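(* Let $X$ and $F$ be sets, let $M$ be a metrizable space (with a fixed compatible metric $d$), let $\kappa$ be a cardinal number, and let $\Phi : X\times F\to M$ be a map such that $K=\overline{F}^{\,M^X}$, the closure of (the image of) $F$ in $M^X$, is compact. Then the following assertions hold. (a) If $\operatorname{d}(X_F)\le\kappa$, then $\operatorname{w}(K)\le\kappa$. (b) If $\operatorname{w}(M)\cdot\operatorname{w}(K)\le\kappa$, then $\operatorname{d}(X_F)\le\kappa$.
   Context: Each $f\in F$ is regarded as the function $\Phi_f\in M^X$, $\Phi_f(x)=\Phi(x,f)$, identifying elements of $F$ that define the same function; thus $F$ is regarded as a subset of $M^X$, and the closure of $F$ in $M^X$ is the closure of $\{\Phi_f: f\in F\}$ in the product topology (topology of pointwise convergence). $X_F$ denotes the set $X$ with the topology of the pseudo-metric $d_F(x,y)=\sup_{f\in F} d(f(x),f(y))$. $\operatorname{d}(\cdot)$ is the density (least cardinality of a dense subset) and $\operatorname{w}(\cdot)$ the weight (least cardinality of an open base).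
   Formalization: The cardinal κ is assumed infinite; for finite κ the statement fails, e.g. (a) with X a point, F = M = [0,1], Φ(x,f) = f gives d(X_F) = 1 but w(K) = ℵ₀, and (b) fails for the three coordinate functions on X = {0,1}³. *)

(* Defs.v *)
From HB Require Import structures.
From mathcomp Require Import all_boot all_order all_algebra.
From mathcomp Require Import all_classical all_reals all_analysis.

Set Implicit Arguments.
Unset Strict Implicit.
Unset Printing Implicit Defensive.

Import Order.TTheory GRing.Theory Num.Theory.

Local Open Scope classical_set_scope.
Local Open Scope card_scope.
Local Open Scope ring_scope.

Definition least_card_in {T : Type} (P : set (set T)) (A : set T) : Prop :=
  P A /\ forall B, P B -> A #<= B.

Lemma least_card_exists {T : Type} (P : set (set T)) :
  P !=set0 -> exists A, least_card_in P A.
Proof.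
move=> [A0 PA0].
pose G : set (set (set T -> T)) := fun C =>
  forall A, P A -> (forall g, C g -> A (g A)) /\
    (forall g h, C g -> C h -> g A = h A -> g = h).
have [|C [GC Cmax]] := @Zorn_bigcup _ G.
  move=> H HG Htot A PA; split.
    by move=> g [D HD Dg]; have [inA _] := HG D HD A PA; exact: inA.
  move=> g h [D HD Dg] [E HE Eh] gh.
  have [DE|ED] := Htot D E HD HE.
    by have [_] := HG E HE A PA; apply => //; exact: DE.
  by have [_] := HG D HD A PA; apply => //; exact: ED.
have [A [PA Asurj]] : exists A, P A /\ A `<=` (fun g => g A) @` C.
  apply: contrapT => nA.
  have ext A : exists a, P A -> A a /\ ~ ((fun g => g A) @` C) a.
    have ptA B : P B -> exists a, B a /\ ~ ((fun g => g B) @` C) a.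
      move=> PB; apply: contrapT => nB; apply: nA; exists B; split=> // b Bb.
      by apply: contrapT => nb; apply: nB; exists b.
    have [PA|nPA] := pselect (P A).
      by have [a ha] := ptA A PA; exists a.
    by have [a _] := ptA A0 PA0; exists a.
  have [g gP] := choice ext.
  have nCg : ~ C g.
    by move=> Cg; have [_ ng] := gP A0 PA0; apply: ng; exists g.
  apply: (Cmax (C `|` [set g])).
    split=> [h Ch|gC]; first by left.
    by apply: nCg; apply: gC; right.
  move=> B PB; have [CB injB] := GC B PB; have [Bg ngB] := gP B PB; split.
    by move=> h [/CB//|->].
  move=> h k [Ch|->] [Ck|->] // hk.
  - exact: injB.
  - by case: ngB; exists h.
  - by case: ngB; exists k.
exists A; split=> // B PB.
apply: (@card_le_trans _ _ _ C).
  exact: card_le_trans (subset_card_le Asurj) (card_image_le _ _).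
have [CB injB] := GC B PB.
have CeqB : (fun g : set T -> T => g B) @` C #= C.
  by apply: inj_card_eq => g h /set_mem Cg /set_mem Ch; exact: injB.
rewrite -(card_le_eql CeqB).
by apply: subset_card_le => _ [g Cg <-]; exact: CB.
Qed.

(* A member of P of least cardinality; it stands for the cardinal
   min { |A| : A in P }. *)
Definition least_card {T : Type} (P : set (set T)) : set T :=
  get (least_card_in P).

Lemma least_cardP {T : Type} (P : set (set T)) :
  P !=set0 -> least_card_in P (least_card P).
Proof. by move=> /least_card_exists; exact: getPex. Qed.

Definition density (T : topologicalType) : set T := least_card (@dense T).
Arguments density T : clear implicits.

Lemma densityP (T : topologicalType) : least_card_in (@dense T) (density T).
Proof.
apply: least_cardP; exists setT => O O0 _.
by rewrite setIT.
Qed.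

Definition weight (T : topologicalType) : set (set T) := least_card (@basis T).
Arguments weight T : clear implicits.

Lemma weightP (T : topologicalType) : least_card_in (@basis T) (weight T).
Proof.
apply: least_cardP; exists open; split=> // x B.
by rewrite nbhsE => -[U [oU Ux] UB]; exists U.
Qed.

Section function_space.
Context {R : realType} {M : metricType R} {X F : Type} (Phi : X * F -> M).

Definition fun_of (f : F) : {ptws X -> M} := fun x => Phi (x, f).

Definition F_closure : set {ptws X -> M} := closure (range fun_of).

(* Extended-real valued, so that it is a pseudometric for every Phi; it is
   finite as soon as each set {Phi (x, f) : f in F} is bounded, in particular
   when F_closure is compact. The element 0 only matters when F is empty: it
   makes F_dist equal to 0 instead of -oo. *)
Definition F_dist (x y : X) : \bar R :=
  ereal_sup
    (0%E |` [set (mdist (fun_of f x) (fun_of f y))%:E | f in [set: F]]).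

Lemma F_dist_ge0 x y : (0 <= F_dist x y)%E.
Proof. by apply: ereal_sup_ubound; left. Qed.

Lemma F_distxx x : F_dist x x = 0%E.
Proof.
apply/eqP; rewrite eq_le F_dist_ge0 andbT.
by apply: ge_ereal_sup => _ [->//|[f _ <-]]; rewrite mdistxx.
Qed.

Lemma F_dist_sym x y : F_dist x y = F_dist y x.
Proof.
rewrite /F_dist; congr (ereal_sup (_ |` _)).
by apply: eq_imagel => f _; rewrite metric_sym.
Qed.

Lemma F_dist_triangle y x z : (F_dist x z <= F_dist x y + F_dist y z)%E.
Proof.
apply: ge_ereal_sup => _ [->|[f _ <-]].
  by apply: adde_ge0; exact: F_dist_ge0.
apply: (@le_trans _ _
  ((mdist (fun_of f x) (fun_of f y))%:E +
   (mdist (fun_of f y) (fun_of f z))%:E)%E).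
  by rewrite -EFinD lee_fin metric_triangle.
by apply: leeD; apply: ereal_sup_ubound; right; exists f.
Qed.

End function_space.

(* A copy of X that carries the topology of F_dist Phi. *)
Definition XF {R : realType} {M : metricType R} {X F : Type}
  (Phi : X * F -> M) : Type := X.

Section XF_topology.
Context {R : realType} {M : metricType R} {X F : Type} (Phi : X * F -> M).

HB.instance Definition _ := gen_eqMixin (XF Phi).
HB.instance Definition _ := gen_choiceMixin (XF Phi).

Definition XF_ball (x : XF Phi) (e : R) : set (XF Phi) :=
  [set y | (F_dist Phi x y < e%:E)%E].

HB.instance Definition _ :=
  hasNbhs.Build (XF Phi) (nbhs_ (entourage_ XF_ball)).

Let ball_center (x : XF Phi) (e : R) : 0 < e -> XF_ball x e x.
Proof. by move=> e0; rewrite /XF_ball/= F_distxx lte_fin. Qed.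

Let ball_sym (x y : XF Phi) (e : R) : XF_ball x e y -> XF_ball y e x.
Proof. by rewrite /XF_ball/= F_dist_sym. Qed.

Let ball_triangle (x y z : XF Phi) (e1 e2 : R) :
  XF_ball x e1 y -> XF_ball y e2 z -> XF_ball x (e1 + e2) z.
Proof.
rewrite /XF_ball/= => xy yz; apply: (le_lt_trans (F_dist_triangle Phi y x z)).
by rewrite EFinD; exact: lteD.
Qed.

HB.instance Definition _ := @Nbhs_isPseudoMetric.Build R (XF Phi)
  (entourage_ XF_ball) erefl XF_ball ball_center ball_sym ball_triangle erefl.

End XF_topology.

(* Main.v *)
Require Import Defs.
From mathcomp Require Import all_boot all_order all_algebra.
From mathcomp Require Import all_classical all_reals all_analysis.
From mathcomp Require Import lra.

(** Write K for the closure of F and let X act on K by the evaluations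
    [evalK x : g |-> g x], which are continuous and determine the topology of K.
    The inequality [d (f x) (f y) <= d_F x y] passes from F to its closure K
    ([evalK_dist]); hence d_F is the pullback to X of the uniform distance
    between continuous maps from K to M.

    Both inequalities are counting arguments in which a set of cardinality at
    most kappa is obtained from finite sequences over kappa; there are no more
    than kappa of those, because kappa * kappa = kappa
    ([infinite_pairing], [card_seq_infinite]).

    (a) Let D be dense in X_F.  For z in D and n, compactness gives a finite
    open cover of K by sets on which [evalK z] varies by less than 1 / (n + 1).
    All the members of all these covers form a subbase of K: a point x of X is
    d_F-close to some z in D, so a small variation of [evalK z] forces a small
    variation of [evalK x], and controlling each [evalK x] is exactly
    convergence in K.  The finite intersections of the subbase are a base of
    cardinality at most kappa.

    (b) Take bases of M and of K.  A finite sequence of pairs (V, U) of basic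
    sets is a constraint on y in X: each U is mapped into V by [evalK y].
    Choose one y for each satisfiable constraint.  Given x and e > 0, cover K
    by finitely many U that [evalK x] maps into some V of diameter at most e / 2.
    The y chosen for this constraint has [g x] and [g y] in the same small V
    for all g in K, so it is d_F-close to x: the chosen points are dense. *)

Set Implicit Arguments.
Unset Strict Implicit.
Unset Printing Implicit Defensive.

Import Order.TTheory GRing.Theory Num.Theory.

Local Open Scope classical_set_scope.
Local Open Scope card_scope.

(** * Comparison and enumeration of cardinals *)

(** A least element of the pair formed by A and B, moved into a common type,
    is below the other one. *)
Lemma card_le_total (T U : Type) (A : set T) (B : set U) :
  A #<= B \/ B #<= A.
Proof.
have inlA : (inl : T -> T + U) @` A #= A.
  by apply: inj_card_eq => x y _ _ [].
have inrB : (inr : U -> T + U) @` B #= B.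
  by apply: inj_card_eq => x y _ _ [].
have [|C [PC Cmin]] := @least_card_exists (T + U)%type
    [set C | C = inl @` A \/ C = inr @` B].
  by exists (inl @` A); left.
have {}Cmin := (Cmin _ (or_introl erefl), Cmin _ (or_intror erefl)).
case: PC Cmin => -> [CA CB].
- by left; rewrite -(card_le_eql inlA) -(card_le_eqr inrB).
- by right; rewrite -(card_le_eql inrB) -(card_le_eqr inlA).
Qed.

Lemma card_le_fun {T U : Type} {A : set T} {B : set U} (u0 : U) : A #<= B ->
  exists f : T -> U, (forall x, A x -> B (f x)) /\
    (forall x y, A x -> A y -> f x = f y -> x = y).
Proof.
move=> /card_leP[f].
exists (fun x => if pselect (A x) is left Ax
  then set_val (f (exist _ x (mem_set Ax))) else u0); split.
  by move=> x Ax; case: pselect => // A'x; exact: set_valP.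
move=> x y Ax Ay; case: pselect => // A'x; case: pselect => // A'y.
move=> /val_inj/(@inj _ _ _ f); rewrite !in_setT => /(_ isT isT).
by case.
Qed.

Lemma fun_card_le {T U : Type} {A : set T} {B : set U} (f : T -> U) :
  (forall x, A x -> B (f x)) ->
  (forall x y, A x -> A y -> f x = f y -> x = y) -> A #<= B.
Proof.
move=> fB finj; apply: (@card_le_trans _ _ _ (f @` A)).
  rewrite (card_le_eqr (@inj_card_eq _ _ A f _)) //.
  by move=> x y /set_mem Ax /set_mem; exact: finj.
by apply: subset_card_le => _ [x Ax <-]; exact: fB.
Qed.
Arguments fun_card_le {T U A B} f.

Lemma partial_inverse {T U : Type} {A : set T} (f : T -> U) (t0 : T) :
  (forall x y, A x -> A y -> f x = f y -> x = y) ->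
  exists g : U -> T, (forall u, A (g u) \/ g u = t0) /\
    (forall x, A x -> g (f x) = x).
Proof.
move=> finj.
have /choice[g gP] u : exists t, (A t \/ t = t0) /\
    forall x, A x -> f x = u -> t = x.
  have [[x Ax fx]|nx] := pselect (exists2 x, A x & f x = u).
    by exists x; split=> [|y Ay fy]; [left|apply: finj => //; rewrite fx].
  by exists t0; split=> [|x Ax fx]; [right|case: nx; exists x].
exists g; split=> [u|x Ax]; first by have [] := gP u.
by have [_] := gP (f x); exact.
Qed.

Lemma card_le_enum {T U : Type} {A : set T} {B : set U} (t0 : T) : A #<= B ->
  exists g : U -> T, (forall u, A (g u) \/ g u = t0) /\
    (forall x, A x -> exists2 u, B u & g u = x).
Proof.
move=> AB; have [[x0 Ax0]|A0] := pselect (A !=set0); last first.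
  by exists (fun=> t0); split=> [u|x Ax]; [right|case: A0; exists x].
have [u0] : inhabited U.
  case/card_leP: AB => f.
  exact: (inhabits (set_val (f (exist _ x0 (mem_set Ax0))))).
have [f [fB finj]] := card_le_fun u0 AB.
have [g [gA gf]] := partial_inverse t0 finj.
exists g; split=> // x Ax.
by exists (f x); [exact: fB|exact: gf].
Qed.

(** * The square of an infinite cardinal *)

Section pairing.
Context {T : Type}.

Definition pairing_on (A : set T) (p : T -> T -> T) :=
  (forall u v, A u -> A v -> A (p u v)) /\
  (forall u v u' v', A u -> A v -> A u' -> A v' ->
    p u v = p u' v' -> u = u' /\ v = v').

(** Zorn's lemma below compares pairings by inclusion of these graphs, which
    forget the values of p outside of A. *)
Definition pairing_graph (A : set T) (p : T -> T -> T) : set (T * T * T) :=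
  [set t | [/\ A t.1.1, A t.1.2 & t.2 = p t.1.1 t.1.2]].

Definition two_points (A : set T) := exists a b, [/\ A a, A b & a <> b].

(** A set A with a pairing has room for two disjoint copies of itself,
    [p a] and [p b] for distinct a and b; so it also has room for
    any S such that S minus A embeds in A. *)
Lemma pairing_absorb (S A : set T) (p : T -> T -> T) (h : T -> T) :
  pairing_on A p -> two_points A ->
  (forall u, S u -> ~ A u -> A (h u)) ->
  (forall u v, S u -> S v -> ~ A u -> ~ A v -> h u = h v -> u = v) ->
  exists e : T -> T, (forall u, S u -> A (e u)) /\
    (forall u v, S u -> S v -> e u = e v -> u = v).
Proof.
move=> [pA pinj] [a [b [Aa Ab ab]]] hA hinj.
exists (fun u => if `[< A u >] then p a u else p b (h u)); split.
  by move=> u Su; case: asboolP => Au; apply: pA => //; exact: hA.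
move=> u v Su Sv; case: asboolP => Au; case: asboolP => Av puv.
- by have [] := pinj _ _ _ _ Aa Au Aa Av puv.
- by have [] := pinj _ _ _ _ Aa Au Ab (hA _ Sv Av) puv.
- by have [/esym] := pinj _ _ _ _ Ab (hA _ Su Au) Aa Av puv.
- have [_] := pinj _ _ _ _ Ab (hA _ Su Au) Ab (hA _ Sv Av) puv.
  exact: hinj.
Qed.

(** If h embeds A in its complement, the pairs with a coordinate outside
    of A can be sent injectively into the copy [h @` A]: absorb both
    coordinates into A, pair them there and apply h.  The old values of the
    pairing are kept. *)
Lemma pairing_extend (A : set T) (p : T -> T -> T) (h : T -> T) :
  pairing_on A p -> two_points A ->
  (forall u, A u -> ~ A (h u)) ->
  (forall u v, A u -> A v -> h u = h v -> u = v) ->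
  exists q, pairing_on (A `|` h @` A) q /\
    (forall u v, A u -> A v -> q u v = p u v).
Proof.
move=> pairp A2 hA hinj.
have [a [_ [Aa _ _]]] := A2.
have [g [_ gh]] := partial_inverse a hinj.
have [e [eA einj]] : exists e : T -> T,
    (forall u, (A `|` h @` A) u -> A (e u)) /\
    (forall u v, (A `|` h @` A) u -> (A `|` h @` A) v -> e u = e v -> u = v).
  apply: (@pairing_absorb _ A p g) => //.
    by move=> _ [//|[u Au <-]] _; rewrite gh.
  move=> _ _ [?//|[u Au <-]] [?//|[v Av <-]] _ _.
  by rewrite !gh // => ->.
have [pA pinj] := pairp.
exists (fun u v => if `[< A u /\ A v >] then p u v else h (p (e u) (e v))).
split; last by move=> u v Au Av; case: asboolP => // -[].
split.
  move=> u v Su Sv; case: asboolP => [[Au Av]|_]; first by left; exact: pA.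
  by right; exists (p (e u) (e v)) => //; apply: pA; exact: eA.
move=> u v u' v' Su Sv Su' Sv'.
have Ae := pA _ _ (eA _ Su) (eA _ Sv).
have Ae' := pA _ _ (eA _ Su') (eA _ Sv').
case: asboolP => [[Au Av]|_]; case: asboolP => [[Au' Av']|_] E.
- exact: pinj.
- by case: (hA _ Ae'); rewrite -E; exact: pA.
- by case: (hA _ Ae); rewrite E; exact: pA.
- have {E} := hinj _ _ Ae Ae' E.
  move=> /(pinj _ _ _ _ (eA _ Su) (eA _ Sv) (eA _ Su') (eA _ Sv'))[E1 E2].
  by split; exact: einj.
Qed.

(** Any two elements of the union of a chain lie in one graph of the chain, so
    the defining properties of a pairing, which involve at most two values of
    p at a time, are inherited by the union. *)
Lemma pairing_chain (H : set (set (T * T * T))) :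
  H !=set0 ->
  (forall G, H G ->
     exists A p, [/\ G = pairing_graph A p, pairing_on A p & two_points A]) ->
  total_on H subset ->
  exists A p, [/\ \bigcup_(G in H) G = pairing_graph A p, pairing_on A p &
    two_points A].
Proof.
move=> [G0 HG0] Hgraph Htot; set U := \bigcup_(G in H) G.
have common s t : U s -> U t ->
    exists A p, [/\ pairing_graph A p s, pairing_graph A p t,
      pairing_graph A p `<=` U & pairing_on A p].
  move=> [G HG Gs] [G' HG' G't].
  have [GG'|G'G] := Htot _ _ HG HG'.
    have [A [p [E pairp _]]] := Hgraph _ HG'; exists A, p; rewrite -E.
    by split=> //; [exact: GG'|move=> x Gx; exists G'].
  have [A [p [E pairp _]]] := Hgraph _ HG; exists A, p; rewrite -E.
  by split=> //; [exact: G'G|move=> x Gx; exists G].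
(* the domain of a pairing is read off the diagonal of its graph *)
pose A := [set a | exists w, U (a, a, w)].
have AU B p a : pairing_graph B p `<=` U -> B a -> A a.
  by move=> BU Ba; exists (p a a); apply: BU; split.
have Ufun u v w w' : U (u, v, w) -> U (u, v, w') -> w = w'.
  by move=> Uw Uw'; have [B [p [[/= _ _ ->] [/= _ _ ->]]]] := common _ _ Uw Uw'.
have [p pE] : exists p : T -> T -> T,
    forall u v, (exists w, U (u, v, w)) -> U (u, v, p u v).
  have /choice[p pP] (uv : T * T) :
      exists t, (exists w, U (uv, w)) -> U (uv, t).
    by have [[w Uw]|nU] := pselect (exists w, U (uv, w));
      [exists w|exists uv.1].
  by exists (fun u v => p (u, v)) => u v; exact: pP.
have joint u v : A u -> A v -> exists B q,
    [/\ B u, B v, pairing_graph B q `<=` U, pairing_on B q & p u v = q u v].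
  move=> [w Uw] [w' Uw'].
  have [B [q [[/= Bu _ _] [/= Bv _ _] BU pairq]]] := common _ _ Uw Uw'.
  exists B, q; split=> //.
  have Uq : U (u, v, q u v) by apply: BU; split.
  by apply: (Ufun u v) => //; apply: pE; exists (q u v).
exists A, p; split; last 2 first.
- split.
    move=> u v Au Av; have [B [q [Bu Bv BU [qB _] ->]]] := joint u v Au Av.
    by apply: (AU B q) => //; exact: qB.
  move=> u v u' v' Au Av Au' Av' E.
  have [B [q [Bu Bv BU _ Eq]]] := joint u v Au Av.
  have [B' [q' [Bu' Bv' BU' _ Eq']]] := joint u' v' Au' Av'.
  have Uuv : U (u, v, p u v) by apply: BU; rewrite Eq; split.
  have Uuv' : U (u', v', p u' v') by apply: BU'; rewrite Eq'; split.
  have [C [r [[/= Cu Cv E1] [/= Cu' Cv' E2] _ [_ rinj]]]] :=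
    common _ _ Uuv Uuv'.
  by apply: rinj => //; rewrite -E1 -E2.
- have [B [q [E _ [a [b [Ba Bb ab]]]]]] := Hgraph _ HG0.
  have BU : pairing_graph B q `<=` U by move=> x; rewrite -E => ?; exists G0.
  by exists a, b; split=> //; exact: (AU B q).
- apply/seteqP; split=> [[[u v] w] Uw|[[u v] w] /= [Au Av /= ->]].
    have [B [q [[/= Bu Bv _] _ BU _]]] := common _ _ Uw Uw.
    split => /=; [exact: (AU B q)|exact: (AU B q)|].
    by apply: (Ufun u v) => //; apply: pE; exists w.
  have [B [q [Bu Bv BU _ ->]]] := joint u v Au Av.
  by apply: BU; split.
Qed.

(** Zorn's lemma needs a starting point with two elements: a copy of nat
    in T, with the pairing of natural numbers. *)
Lemma pairing_start : infinite_set [set: T] ->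
  exists A p, pairing_on A p /\ two_points A.
Proof.
move=> /[dup] /infinite_setN0[x0 _] /infiniteP /(card_le_fun x0)[f [_ finj]].
have [g [_ gf]] := partial_inverse 0%N finj.
have {}gf n : g (f n) = n by exact: gf.
have {}finj m n : f m = f n -> m = n by exact: finj.
exists (range f), (fun u v => f (pickle (g u, g v))); split; first split.
- by move=> u v _ _; exists (pickle (g u, g v)).
- move=> _ _ _ _ [m _ <-] [n _ <-] [m' _ <-] [n' _ <-].
  by rewrite !gf => /finj/(pcan_inj pickleK)[-> ->].
- exists (f 0%N), (f 1%N); split; [by exists 0%N|by exists 1%N|].
  by move/finj.
Qed.

(** Consider a maximal pairing, with domain A.  If A embeds in its complement,
    the pairing extends to a larger domain, which is absurd.  So the
    complement embeds in A, hence all of T does, and the pairing of A can be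
    pulled back to T. *)
Theorem infinite_pairing : infinite_set [set: T] ->
  exists p : T -> T -> T, forall u v u' v',
    p u v = p u' v' -> u = u' /\ v = v'.
Proof.
move=> Tinf.
(* the union of the empty chain is empty, so set0 has to be admitted *)
pose P := [set G : set (T * T * T) | G = set0 \/
  exists A p, [/\ G = pairing_graph A p, pairing_on A p & two_points A]].
have [|G [PG Gmax]] := @Zorn_bigcup _ P.
  move=> H HP Htot.
  pose H' := [set G | H G /\ G !=set0].
  have UE : \bigcup_(G in H) G = \bigcup_(G in H') G.
    apply/seteqP; split=> [x [G HG Gx]|x [G [HG _] Gx]]; exists G => //.
    by split=> //; exists x.
  have [H'0|H'0] := pselect (H' !=set0); last first.
    left; rewrite UE; apply/seteqP; split=> // x [G H'G].
    by case: H'0; exists G.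
  right; rewrite UE; apply: pairing_chain => //.
    by move=> G [HG [x Gx]]; case: (HP _ HG) => // G0; rewrite G0 in Gx.
  by move=> G G' [HG _] [HG' _]; exact: Htot.
case: PG => [G0|[A [p [GE pairp A2]]]].
  have [A [p [pairp A2]]] := pairing_start Tinf.
  exfalso; apply: (Gmax (pairing_graph A p)); last by right; exists A, p.
  rewrite G0; split=> // sub.
  by have [a [_ [Aa _ _]]] := A2; apply: (sub (a, a, p a a)); split.
have [t0 _] := infinite_setN0 Tinf.
have [/(card_le_fun t0)[h [hA hinj]]|/(card_le_fun t0)[h [hA hinj]]] :=
  card_le_total A (~` A).
  have [q [pairq qE]] := pairing_extend pairp A2 hA hinj.
  exfalso; apply: (Gmax (pairing_graph (A `|` h @` A) q)).
    rewrite GE; split.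
      move=> [[u v] w] [/= Au Av ->]; split=> /=; [by left|by left|].
      by rewrite qE.
    have [a [_ [Aa _ _]]] := A2 => sub.
    have ha : (A `|` h @` A) (h a) by right; exists a.
    have [] : pairing_graph A p (h a, h a, q (h a) (h a)) by exact: sub.
    by move=> /= Aha; case: (hA _ Aa).
  right; exists (A `|` h @` A), q; split=> //.
  by have [a [b [Aa Ab ab]]] := A2; exists a, b; split=> //; left.
have [e [eA einj]] : exists e : T -> T, (forall u, setT u -> A (e u)) /\
    (forall u v, setT u -> setT v -> e u = e v -> u = v).
  apply: (@pairing_absorb _ A p h) => //.
    by move=> u _; exact: hA.
  by move=> u v _ _; exact: hinj.
exists (fun u v => p (e u) (e v)) => u v u' v'.
have [_ pinj] := pairp.
by move=> /pinj[]; do ?exact: eA; move=> /einj-> // /einj->.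
Qed.

End pairing.

(** Folding a pairing over a sequence is injective on sequences of a given
    length; the length is stored in one more pair. *)
Lemma card_seq_infinite (T : Type) : infinite_set [set: T] ->
  [set: seq T] #<= [set: T].
Proof.
move=> Tinf; have [p pinj] := infinite_pairing Tinf.
have [t0 _] := infinite_setN0 Tinf.
have /(card_le_fun t0)[f [_ finj]] := (infiniteP _).1 Tinf.
pose enc : seq T -> T := foldr p t0.
have encinj s s' : size s = size s' -> enc s = enc s' -> s = s'.
  by elim: s s' => [|x s IH] [|x' s'] //= [] ss /pinj[-> /IH-> //].
apply: (fun_card_le (fun s => p (f (size s)) (enc s))) => // s s' _ _.
by move=> /pinj[/finj ss]; apply: encinj; exact: ss.
Qed.

Lemma card_prod_infinite {T U V : Type} (A : set U) (B : set V) :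
  infinite_set [set: T] -> A #<= [set: T] -> B #<= [set: T] ->
  A `*` B #<= [set: T].
Proof.
move=> Tinf AT BT; have [p pinj] := infinite_pairing Tinf.
have [t0 _] := infinite_setN0 Tinf.
have [f [_ finj]] := card_le_fun t0 AT.
have [g [_ ginj]] := card_le_fun t0 BT.
apply: (fun_card_le (fun x => p (f x.1) (g x.2))) => //.
move=> [x y] [x' y'] [/= Ax By] [/= Ax' By'] /pinj[fx gy].
by rewrite (finj _ _ Ax Ax' fx) (ginj _ _ By By' gy).
Qed.

Local Open Scope ring_scope.

(** * Initial topologies, compactness and subbases *)

Lemma cvg_initial {S : choiceType} {T : topologicalType} (f : S -> T)
    (F : set_system S) (s : S) : Filter F ->
  F --> (s : initial_topology f) <-> f @ F --> f s.
Proof.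
move=> FF; split=> [Fs A /initial_continuous/Fs//|fFs].
move=> A /= [_ [[B oB <-] Bfs BA]].
have /fFs FB : nbhs (f s) B by apply: open_nbhs_nbhs.
exact: filterS BA FB.
Qed.

Lemma cvg_ptws {X : Type} {T : topologicalType}
    (F : set_system {ptws X -> T}) (f : {ptws X -> T}) : Filter F ->
  F --> f <-> forall x, g x @[g --> F] --> f x.
Proof.
move=> FF; split=> [/cvg_sup Ff x|Ff].
  exact: (cvg_initial (fun g : X -> T => g x) f FF).1 (Ff x).
apply/cvg_sup => x.
exact: (cvg_initial (fun g : X -> T => g x) f FF).2 (Ff x).
Qed.

Lemma set_val_continuous {T : topologicalType} (A : set T) :
  continuous (set_val : A -> T).
Proof. exact: initial_continuous. Qed.

Lemma compact_set_type {T : topologicalType} (A : set T) :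
  compact A -> compact [set: A].
Proof.
move=> cA F PF _.
have [|p [Ap clp]] := cA (set_val @ F) (fmap_proper_filter _ PF).
  by apply: (@filterE _ F) => x; exact: set_valP.
exists (exist _ p (mem_set Ap)); split=> // B C FB [_ [[V oV <-] Vp VC]].
have [] := clp (set_val @` B) V.
- by apply: (@filterS _ F _ _ _ _ FB) => x Bx; exists x.
- exact: open_nbhs_nbhs.
by move=> _ [[x Bx <-] Vx]; exists x; split=> //; exact: VC.
Qed.

(** The cover is indexed by the points themselves.  The filter of all finite
    sequences that contain a given one turns the near-covering form of
    compactness into the extraction of a finite subcover. *)
Lemma compact_finite_cover {T : topologicalType} (N : T -> set T) :
  compact [set: T] -> (forall x, nbhs x (N x)) ->
  exists s : seq T, forall y, exists2 x, x \in s & N x y.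
Proof.
move=> /compact_near_coveringP cT Nn.
pose G : set_system (seq T) :=
  filter_from [set: seq T] (fun l => [set s : seq T | {subset l <= s}]).
have FG : Filter G.
  apply: filter_from_filter; first by exists [::].
  move=> l l' _ _; exists (l ++ l') => // s ss.
  by split=> x xl; apply: ss; rewrite mem_cat xl ?orbT.
have [|s _ sP] := cT _ G (fun s y => exists2 x, x \in (s : seq T) & N x y) FG.
  move=> x _; exists (N x, [set s : seq T | x \in s]) => /=.
    split; first exact: Nn.
    by exists [:: x] => // s; apply; rewrite mem_head.
  by move=> [y s] [/= Ny xs]; exists x.
by exists s => y; apply: (sP s).
Qed.

(** The hypothesis on filters says that S is a subbase: membership in the
    S-neighbourhoods of x already forces convergence to x.  It is applied to
    the filter generated by the finite intersections that contain x, which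
    makes them a base. *)
Lemma weight_le_subbase {T : topologicalType} {kappa : Type}
    (S : set (set T)) : infinite_set [set: kappa] ->
  S #<= [set: kappa] -> S `<=` open ->
  (forall (x : T) (F : set_system T), Filter F ->
     (forall U, S U -> U x -> F U) -> F --> x) ->
  weight T #<= [set: kappa].
Proof.
move=> kinf Sk Sopen Scvg.
have [_ wle] := weightP T.
have [g [gS gsurj]] := card_le_enum setT Sk.
(* outside of the enumerated family g takes the value setT, which is open *)
have gopen k : open (g k) by case: (gS k) => [/Sopen//|->]; exact: openT.
pose I s := \big[setI/setT]_(k <- s) g k.
have IB : basis (range I).
  split.
    move=> _ [s _ <-]; rewrite /I; elim/big_ind: _ => //; first exact: openT.
    exact: openI.
  move=> x; apply: Scvg.
    apply: filter_from_filter.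
      by exists setT; split=> //; exists [::] => //; rewrite /I big_nil.
    move=> _ _ [[s _ <-] sx] [[s' _ <-] s'x].
    have Icat : I (s ++ s') = I s `&` I s' by exact: big_cat.
    exists (I (s ++ s')); last by rewrite Icat.
    by split; [exists (s ++ s')|rewrite Icat].
  move=> U SU Ux; have [k _ gk] := gsurj _ SU.
  exists U => //; split=> //; exists [:: k] => //.
  by rewrite /I big_seq1.
apply: card_le_trans (wle _ IB) _.
exact: card_le_trans (card_image_le _ _) (card_seq_infinite kinf).
Qed.

Lemma mdist_ball {R : realType} {M : metricType R} (x y : M) (e : R) :
  ball x e y = (mdist x y < e).
Proof. by rewrite ballEmdist. Qed.

(** * Evaluation maps on the closure of F *)

Section weight_density.
Context {R : realType} {M : metricType R} {X F : Type} (Phi : X * F -> M).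
Local Notation K := (F_closure Phi : Type).

Definition evalK (x : X) (g : K) : M := (set_val g : X -> M) x.

Lemma evalK_continuous x : continuous (evalK x).
Proof.
move=> g.
have Kg : (set_val : K -> {ptws X -> M}) @ nbhs g --> set_val g.
  exact: (@set_val_continuous {ptws X -> M} (F_closure Phi) g).
exact: (cvg_ptws (set_val g) (fmap_filter _ _)).1 Kg x.
Qed.

Lemma cvg_evalK (G : set_system K) (g : K) : Filter G ->
  (forall x, evalK x @ G --> evalK x g) -> G --> g.
Proof.
move=> FG Gg; apply/(@cvg_initial _ _ (set_val : K -> {ptws X -> M})).
by apply/cvg_ptws.
Qed.

(** The pseudometric of X_F is a supremum over F only; since mdist is
    continuous the bound holds at every function of the closure. *)
Lemma evalK_dist (x y : X) (r : R) (g : K) :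
  (F_dist Phi x y <= r%:E)%E -> mdist (evalK x g) (evalK y g) <= r.
Proof.
move=> xyr; apply/ler_addgt0Pr => e e0.
pose O := [set h : {ptws X -> M} |
  ball (evalK x g) (e / 2) (h x) /\ ball (evalK y g) (e / 2) (h y)].
have gO : nbhs (set_val g) O.
  have gcvg := (cvg_ptws (set_val g) (nbhs_filter _)).1 cvg_id.
  have e2 : 0 < e / 2 by rewrite divr_gt0.
  apply: filterI.
    exact: (gcvg x _ (nbhsx_ballx (evalK x g) _ e2)).
  exact: (gcvg y _ (nbhsx_ballx (evalK y g) _ e2)).
have [_ [[f _ <-] [fx fy]]] := set_valP g O gO.
have fr : mdist (fun_of Phi f x) (fun_of Phi f y) <= r.
  rewrite -lee_fin; apply: le_trans xyr.
  by apply: ereal_sup_ubound; right; exists f.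
apply: (le_trans (metric_triangle _ (fun_of Phi f x) _)).
rewrite [in leRHS](splitr e) addrCA; apply: lerD.
  by rewrite ltW // -mdist_ball.
apply: (le_trans (metric_triangle _ (fun_of Phi f y) _)).
by rewrite lerD // ltW // metric_sym -mdist_ball.
Qed.

(** A sequence of open sets, padded with [setT], is used rather than a
    finite net of values, because M may be empty and then has no default value
    for [nth]. *)
Lemma evalK_finite_cover (x : X) (e : R) : compact (F_closure Phi) -> 0 < e ->
  exists l : seq (set K), (forall k, open (nth setT l k)) /\
    forall g, exists k, nth setT l k g /\
      forall h, nth setT l k h -> mdist (evalK x g) (evalK x h) < e.
Proof.
move=> /compact_set_type cK e0.
pose N (g : K) := evalK x @^-1` (ball (evalK x g) (e / 2))°.
have Nopen g : open (N g).
  by apply: open_comp; [move=> h _; exact: evalK_continuous|exact: open_interior].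
have Nself g : N g g by apply: nbhsx_ballx; rewrite divr_gt0.
have [|s sP] := compact_finite_cover (N := N) cK.
  by move=> g; apply: open_nbhs_nbhs.
exists (map N s); split.
  move=> k; have [ks|ks] := ltnP k (size s).
    have [g0 _] : exists g, g \in s.
      by case: s ks {sP} => // g s _; exists g; rewrite mem_head.
    by rewrite (nth_map g0).
  by rewrite nth_default ?size_map //; exact: openT.
move=> g; have [c cs Ncg] := sP g; exists (index c s).
rewrite (nth_map c) ?index_mem // nth_index //; split=> // h Nch.
rewrite (splitr e); apply: (le_lt_trans (metric_triangle _ (evalK x c) _)).
apply: ltrD; last by rewrite -mdist_ball; exact: interior_subset.
by rewrite metric_sym -mdist_ball; exact: interior_subset.
Qed.

(** * The two inequalities *)

Lemma weight_le_density {kappa : Type} : infinite_set [set: kappa] ->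
  compact (F_closure Phi) ->
  density (XF Phi) #<= [set: kappa] -> weight (F_closure Phi) #<= [set: kappa].
Proof.
move=> kinf cK dk; have [dD _] := densityP (XF Phi).
set D := density _ in dk dD.
have /choice[l lP] (xn : X * nat) : exists l : seq (set K),
    (forall k, open (nth setT l k)) /\
    forall g, exists k, nth setT l k g /\
      forall h, nth setT l k h ->
        mdist (evalK xn.1 g) (evalK xn.1 h) < xn.2.+1%:R^-1.
  exact: evalK_finite_cover.
(* t stands for (z, (n, k)): the k-th set of the n-th cover attached to z *)
pose S := (fun t : X * (nat * nat) => nth setT (l (t.1, t.2.1)) t.2.2) @`
  (D `*` [set: nat * nat]).
apply: (@weight_le_subbase _ _ S) => //.
- apply: (card_le_trans (card_image_le _ _)).
  apply: card_prod_infinite => //.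
  exact: card_le_trans (countableP _) ((infiniteP _).1 kinf).
- by move=> _ [t _ <-]; have [] := lP (t.1, t.2.1).
move=> g G FG GS; apply: cvg_evalK => x.
apply/cvg_ballP => e e0.
have e4 : 0 < e / 4 by rewrite divr_gt0.
have [n] := ltr_add_invr e4; rewrite add0r => ne.
have [z [zx Dz]] : ((ball (x : XF Phi) (e / 4))° `&` D) !=set0.
  apply: dD; last exact: open_interior.
  by exists x; apply: nbhsx_ballx.
have {}zx : (F_dist Phi x z <= (e / 4)%:E)%E.
  by rewrite ltW //; exact: (interior_subset zx).
have [k [kg kP]] := (lP (z, n)).2 g.
have Gk : G (nth setT (l (z, n)) k) by apply: GS => //; exists (z, (n, k)).
apply: filterS Gk => h /kP /= gh.
rewrite mdist_ball.
(* g x ~ g z ~ h z ~ h x, each within e / 4 *)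
apply: (le_lt_trans (metric_triangle _ (evalK z g) _)).
apply: (@le_lt_trans _ _ (e / 4 + (e / 4 + e / 4))).
  rewrite lerD ?evalK_dist //.
  apply: (le_trans (metric_triangle _ (evalK z h) _)).
  by rewrite lerD ?(ltW (lt_trans gh ne)) // metric_sym evalK_dist.
lra.
Qed.

Lemma density_le_weight {kappa : Type} : infinite_set [set: kappa] ->
  compact (F_closure Phi) ->
  weight M `*` weight (F_closure Phi) #<= [set: kappa] ->
  density (XF Phi) #<= [set: kappa].
Proof.
move=> kinf /compact_set_type cK wk; have [_ dle] := densityP (XF Phi).
have [[oBM BM] _] := weightP M; have [[oBK BK] _] := weightP (F_closure Phi).
have [[x0]|nX] := pselect (inhabited X); last first.
  apply: card_le_trans (dle set0 _) _; last exact: card_ge0.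
  by move=> O [x _]; case: nX.
have [E [_ Esurj]] := card_le_enum (set0, set0) wk.
(* E k is a pair (V, U), and y fits k when evalK y maps U into V *)
pose fits (y : X) k := `[< forall g, (E k).2 g -> (E k).1 (evalK y g) >].
have /choice[pick pickP] (s : seq kappa) :
    exists y, (exists x, all (fits x) s) -> all (fits y) s.
  by have [[x xs]|nx] := pselect (exists x, all (fits x) s); [exists x|exists x0].
apply: card_le_trans (dle (range pick) _) _; last first.
  exact: card_le_trans (card_image_le _ _) (card_seq_infinite kinf).
move=> O [x Ox] oO.
have /nbhs_ballP[e /= e0 eO] : nbhs x O by exact: open_nbhs_nbhs.
have e2 : 0 < e / 2 by rewrite divr_gt0.
have e4 : 0 < e / 2 / 2 by rewrite divr_gt0.
have /choice[u uP] (g : K) : exists k, [/\ fits x k, nbhs g (E k).2 &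
    (E k).1 `<=` ball (evalK x g) (e / 2 / 2)].
  have [V [BV Vg] Ve] := BM (evalK x g) _ (nbhsx_ballx _ _ e4).
  have gV : nbhs g (evalK x @^-1` V).
    by apply: evalK_continuous; apply: open_nbhs_nbhs; split=> //; exact: oBM.
  have [U [BU Ug] UV] := BK g _ gV.
  have [k _ kE] := Esurj (V, U) (conj BV BU).
  exists k; rewrite kE; split=> //=.
    by apply/asboolP; rewrite kE.
  by apply: open_nbhs_nbhs; split=> //; exact: oBK.
have [|s sP] := compact_finite_cover (N := fun g => (E (u g)).2) cK.
  by move=> g; have [] := uP g.
have fits_x : all (fits x) (map u s).
  by rewrite all_map; apply/allP => g _ /=; have [] := uP g.
have := pickP (map u s) (ex_intro _ x fits_x).
set y := pick (map u s); rewrite all_map => /allP fits_y.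
exists y; split; last by exists (map u s).
apply: eO; rewrite /ball/= /XF_ball/=.
apply: (@le_lt_trans _ _ (e / 2)%:E); last by rewrite lte_fin; lra.
apply: ge_ereal_sup => _ [->|[f _ <-]]; first by rewrite lee_fin ltW.
have Kf : F_closure Phi (fun_of Phi f) by apply: subset_closure; exists f.
pose h : K := exist (fun f => f \in F_closure Phi) _ (mem_set Kf).
have [g gs gh] := sP h; have [/asboolP gx _ gV] := uP g.
have /asboolP gy : fits y (u g) by exact: fits_y.
have := gV _ (gx _ gh); have := gV _ (gy _ gh); rewrite !mdist_ball.
rewrite /evalK/= => gfy gfx; rewrite lee_fin (splitr (e / 2)).
apply: (le_trans (metric_triangle _ (evalK x g) _)).
by rewrite lerD ?ltW // metric_sym.
Qed.

End weight_density.

Theorem theorem3p1 (R : realType) (X F : Type) (M : metricType R)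
    (kappa : Type) (kappa_inf : infinite_set [set: kappa])
    (Phi : X * F -> M) (Kcompact : compact (F_closure Phi)) :
  (density (XF Phi) #<= [set: kappa] ->
     weight (F_closure Phi) #<= [set: kappa]) /\
  (weight M `*` weight (F_closure Phi) #<= [set: kappa] ->
     density (XF Phi) #<= [set: kappa]).
Proof.
by split; [exact: weight_le_density|exact: density_le_weight].
Qed.
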